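(* Let $\mathcal{C}$ be a Cayley algebra with norm $\mathrm{n}$ over a field $\mathbb{F}$ of characteristic $\neq 2$, and let $\mathcal{C}_0^{-}$ be the central simple Malcev algebra associated with $\mathcal{C}$. Then: (1) the space of all local derivations of $\mathcal{C}_0^{-}$ is the Lie algebra $\mathfrak{so}(\mathcal{C}_0,\mathrm{n})$; (2) if $\mathcal{C}$ is a split algebra, then every $2$-local derivation on $\mathcal{C}_0^{-}$ is a derivation; (3) if $\mathcal{C}$ is a division algebra, then $\mathrm{2LocDer}(\mathcal{C}_0^{-})\cong \mathrm{LocDer}(\mathcal{C}_0^{-})\cong\mathfrak{so}(\mathcal{C}_0,\mathrm{n})$.
   Context: A Cayley algebra over a field $\mathbb{F}$ is a unital (not necessarily associative) $\mathbb{F}$-algebra $\mathcal{C}$ of dimension $8$ endowed with a quadratic form $\mathrm{n}:\mathcal{C}\to\mathbb{F}$ (the norm) that is multiplicative, $\mathrm{n}(xy)=\mathrm{n}(x)\mathrm{n}(y)$ for all $x,y\in\mathcal{C}$, and nonsingular, i.e. its polar form $\mathrm{n}(x,y):=\mathrm{n}(x+y)-\mathrm{n}(x)-\mathrm{n}(y)$ is a nondegenerate bilinear form. $\mathcal{C}$ is split if $\mathrm{n}$ is isotropic ($\mathrm{n}(x)=0$ for some $x\ne 0$; such $\mathcal{C}$ is unique up to isomorphism), and a division algebra if $\mathrm{n}$ is anisotropic (no such $x$). The trace is $t(x)=\mathrm{n}(x,1)$. $\mathcal{C}_0=\{x\in\mathcal{C}\mid t(x)=0\}$, and $\mathcal{C}_0^{-}$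 denotes the vector space $\mathcal{C}_0$ with the multiplication $[x,y]=\frac12(xy-yx)$; it is a simple Malcev algebra. For an algebra $\mathcal{A}$, a derivation is a linear map $d:\mathcal{A}\to\mathcal{A}$ satisfying the Leibniz rule for the multiplication of $\mathcal{A}$. A local derivation is a linear map $\Delta:\mathcal{A}\to\mathcal{A}$ such that for every $x\in\mathcal{A}$ there is a derivation $d_x$ of $\mathcal{A}$ with $\Delta(x)=d_x(x)$. A $2$-local derivation is a map $\Delta:\mathcal{A}\to\mathcal{A}$ (not assumed linear) such that for every pair $x,y\in\mathcal{A}$ there is a derivation $d_{x,y}$ of $\mathcal{A}$ with $\Delta(x)=d_{x,y}(x)$ and $\Delta(y)=d_{x,y}(y)$. $\mathrm{LocDer}(\mathcal{A})$ and $\mathrm{2LocDer}(\mathcal{A})$ denote the sets of local, respectively $2$-local, derivations of $\mathcal{A}$. $\mathfrak{so}(\mathcal{C}_0,\mathrm{n})=\{d\in\mathrm{End}_{\mathbb{F}}(\mathcal{C}_0)\mid \mathrm{n}(v,d(v))=0\ \forall v\in\mathcal{C}_0\}$, with the commutator bracket. *)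

(* Defs.v *)
From HB Require Import structures.
From mathcomp Require Import all_boot all_order all_algebra.
From mathcomp Require Import boolp classical_sets functions.

Set Implicit Arguments.
Unset Strict Implicit.
Unset Printing Implicit Defensive.

Import GRing.Theory.
Local Open Scope classical_set_scope.
Local Open Scope ring_scope.

Definition polar (F : fieldType) (V : lmodType F) (q : V -> F) (x y : V) : F :=
  q (x + y) - q x - q y.

Definition quadratic_form (F : fieldType) (V : lmodType F) (q : V -> F) : Prop :=
  (forall (a : F) (x : V), q (a *: x) = a ^+ 2 * q x)
  /\ bilinear_for *%R *%R (polar q).

Definition nonsingular (F : fieldType) (V : lmodType F) (q : V -> F) : Prop :=
  forall x : V, (forall y : V, polar q x y = 0) -> x = 0.

Definition isotropic (F : fieldType) (V : lmodType F) (q : V -> F) : Prop :=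
  exists x : V, x != 0 /\ q x = 0.

Record cayleyAlgebra (F : fieldType) := CayleyAlgebra {
  cayley_sort :> vectType F;
  cmul : cayley_sort -> cayley_sort -> cayley_sort;
  cone : cayley_sort;
  cnorm : cayley_sort -> F;
  cayley_dim : \dim {: cayley_sort} = 8;
  cmul_bilinear : bilinear_for *:%R *:%R cmul;
  cmul1x : left_id cone cmul;
  cmulx1 : right_id cone cmul;
  cnorm_quadratic : quadratic_form cnorm;
  cnorm_nonsingular : nonsingular cnorm;
  cnormM : forall x y, cnorm (cmul x y) = cnorm x * cnorm y
}.

Definition split_cayley (F : fieldType) (C : cayleyAlgebra F) : Prop :=
  isotropic (@cnorm F C).

Definition division_cayley (F : fieldType) (C : cayleyAlgebra F) : Prop :=
  ~ isotropic (@cnorm F C).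

(* The codomain is the regular module F^o so that the trace can be turned into
   a linear map between vector spaces. *)
Definition ctrace (F : fieldType) (C : cayleyAlgebra F) (x : C) : F^o :=
  polar (@cnorm F C) x (cone C).

Lemma polarC (F : fieldType) (V : lmodType F) (q : V -> F) (x y : V) :
  polar q x y = polar q y x.
Proof. by rewrite /polar (addrC x y) addrAC. Qed.

Lemma polarP (F : fieldType) (V : lmodType F) (q : V -> F) :
  quadratic_form q -> forall (a : F) (u v w : V),
  polar q w (a *: u + v) = a * polar q w u + polar q w v.
Proof. by move=> [_ [_ qr]] a u v w; exact: qr. Qed.

Lemma polarD (F : fieldType) (V : lmodType F) (q : V -> F) :
  quadratic_form q -> forall u v w : V,
  polar q w (u + v) = polar q w u + polar q w v.
Proof.
by move=> qq u v w; have := polarP qq 1 u v w; rewrite scale1r mul1r.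
Qed.

Lemma ctrace_linear (F : fieldType) (C : cayleyAlgebra F) : linear (@ctrace F C).
Proof. exact: (cnorm_quadratic C).2.1. Qed.

HB.instance Definition _ (F : fieldType) (C : cayleyAlgebra F) :=
  GRing.isLinear.Build F C F^o _ (@ctrace F C) (@ctrace_linear F C).

Definition trace0 (F : fieldType) (C : cayleyAlgebra F) : {vspace C} :=
  lker (linfun (@ctrace F C)).

Lemma ctraceM (F : fieldType) (C : cayleyAlgebra F) (x y : C) :
  ctrace (cmul x y) = ctrace x * ctrace y - polar (@cnorm F C) x y.
Proof.
have addl (u v w : C) : cmul (u + v) w = cmul u w + cmul v w.
  have H : cmul (1 *: u + v) w = 1 *: cmul u w + cmul v w.
    exact: (cmul_bilinear C).1.
  by rewrite !scale1r in H.
have addr (u v w : C) : cmul w (u + v) = cmul w u + cmul w v.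
  have H : cmul w (1 *: u + v) = 1 *: cmul w u + cmul w v.
    exact: (cmul_bilinear C).2.
  by rewrite !scale1r in H.
have paddr := polarD (cnorm_quadratic C).
have paddl (u v w : C) : polar (@cnorm F C) (u + v) w =
    polar (@cnorm F C) u w + polar (@cnorm F C) v w.
  by rewrite polarC paddr polarC [polar _ w v]polarC.
have polMl (u v w : C) : polar (@cnorm F C) (cmul u v) (cmul u w) =
    cnorm u * polar (@cnorm F C) v w.
  by rewrite /polar -addr !cnormM -!mulrBr.
have nD (u v : C) :
    cnorm (u + v) = cnorm u + cnorm v + polar (@cnorm F C) u v.
  by rewrite /polar -(addrA (cnorm (u + v))) -opprD [RHS]addrC subrK.
have pol1 (u v : C) : polar (@cnorm F C) (cmul u v) u = cnorm u * ctrace v.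
  by rewrite -[X in polar _ _ X]cmulx1 polMl.
have n1 : cnorm (cone C) * ctrace y = ctrace y by rewrite -pol1 cmul1x.
have := pol1 (x + cone C) y.
rewrite addl cmul1x paddl !paddr pol1 nD.
rewrite -[polar _ (cmul x y) _]/(ctrace (cmul x y)) -[polar _ y (cone C)]/(ctrace y).
rewrite -[polar _ x (cone C)]/(ctrace x) [polar _ y x]polarC.
have dist (a b c d : F) : (a + b + c) * d = a * d + (b * d + c * d).
  by rewrite !mulrDl addrA.
rewrite dist n1 -addrA => /addrI; rewrite addrA [RHS]addrC => /addIr <-.
by rewrite addrK.
Qed.

Lemma malcev_subproof (F : fieldType) (C : cayleyAlgebra F) (x y : C) :
  2%:R^-1 *: (cmul x y - cmul y x) \in trace0 C.
Proof.
rewrite memv_ker lfunE linearZ linearB /= !ctraceM.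
by rewrite [polar _ y x]polarC [ctrace y * _]mulrC subrr scaler0.
Qed.

Definition malcev (F : fieldType) (C : cayleyAlgebra F)
    (x y : subvs_of (trace0 C)) : subvs_of (trace0 C) :=
  Subvs (malcev_subproof (vsval x) (vsval y)).

Definition norm0 (F : fieldType) (C : cayleyAlgebra F)
    (x : subvs_of (trace0 C)) : F := cnorm (vsval x).

Definition Der (F : fieldType) (A : lmodType F) (mul : A -> A -> A) :
    set (A -> A) :=
  [set d | linear d
         /\ forall x y : A, d (mul x y) = mul (d x) y + mul x (d y)].

Definition LocDer (F : fieldType) (A : lmodType F) (mul : A -> A -> A) :
    set (A -> A) :=
  [set D | linear D
         /\ forall x : A, exists2 d, Der mul d & D x = d x].

Definition TwoLocDer (F : fieldType) (A : lmodType F) (mul : A -> A -> A) :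
    set (A -> A) :=
  [set D | forall x y : A, exists2 d, Der mul d & D x = d x /\ D y = d y].

Definition so (F : fieldType) (V : lmodType F) (q : V -> F) : set (V -> V) :=
  [set d | linear d /\ forall v : V, polar q v (d v) = 0].

Definition bracket (F : fieldType) (V : lmodType F) (f g : V -> V) : V -> V :=
  (f \o g) - (g \o f).

(* On maps that are not additive the commutator need not be bilinear, so for a
   set of possibly nonlinear maps these closure properties alone do not give a
   Lie algebra. Below, when one side consists of linear maps, the bijection
   transports the Lie algebra axioms to the other side. *)
Definition bracket_closed (F : fieldType) (V : lmodType F) (L : set (V -> V)) :
    Prop :=
  [/\ L 0,
      forall (a : F) (f g : V -> V), L f -> L g -> L (a *: f + g)
    & forall f g : V -> V, L f -> L g -> L (bracket f g)].

Definition lie_isomorphic (F : fieldType) (V : lmodType F)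
    (L M : set (V -> V)) : Prop :=
  [/\ bracket_closed L, bracket_closed M &
      exists phi : (V -> V) -> (V -> V),
        [/\ set_bij L M phi,
            forall (a : F) (f g : V -> V), L f -> L g ->
              phi (a *: f + g) = a *: phi f + phi g
          & forall f g : V -> V, L f -> L g ->
              phi (bracket f g) = bracket (phi f) (phi g)]].

Lemma so_bracket_closed (F : fieldType) (V : lmodType F) (q : V -> F) :
  quadratic_form q -> bracket_closed (so q).
Proof.
move=> qq; have padd := polarD qq; have qr := polarP qq.
have p0 (w : V) : polar q w 0 = 0.
  by apply: (addrI (polar q w 0)); rewrite -padd !addr0.
have pN (u w : V) : polar q w (- u) = - polar q w u.
  by apply: (addrI (polar q w u)); rewrite -padd !subrr p0.
have lD (f : V -> V) (lf : linear f) u v : f (u + v) = f u + f v.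
  by have := lf 1 u v; rewrite !scale1r => ->; rewrite ?scale1r.
split.
- by split=> [a u v|v]; rewrite /= ?p0 // scaler0 addr0.
- move=> a f g [lf qf] [lg qg]; split=> [b u v|v].
    rewrite !fctE lf lg !scalerDr !scalerA mulrC -!addrA.
    by congr (_ + _); rewrite addrCA.
  by rewrite !fctE qr qf qg mulr0 addr0.
- move=> f g [lf qf] [lg qg].
  have skew h (lh : linear h) (qh : forall v, polar q v (h v) = 0) u v :
      polar q u (h v) = - polar q (h u) v.
    have := qh (u + v); rewrite (lD h) // padd !(polarC q (u + v)) !padd.
    rewrite !(polarC q (h _)) !qh add0r addr0 => /eqP.
    by rewrite addr_eq0 => /eqP ->; rewrite opprK.
  split=> [a u v|v].
    rewrite /bracket !fctE /= !(lf, lg) scalerBr opprD !addrA.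
    by congr (_ - _); rewrite addrAC.
  rewrite /bracket !fctE /= padd pN (skew f lf qf v) (skew g lg qg v).
  by rewrite [polar q (g v) _]polarC opprK addNr.
Qed.

(* Main.v *)
Require Import Defs.
From mathcomp Require Import all_boot all_order all_algebra.
From mathcomp Require Import boolp classical_sets functions.
From mathcomp Require Import ring.

Local Open Scope ring_scope.

Set Implicit Arguments.
Unset Strict Implicit.
Unset Printing Implicit Defensive.

Import GRing.Theory VectorInternalTheory.

(** Write [V] for the trace-zero space, [B] for the polar form of the norm on it
    and [x ** y] for its bracket. The bracket is a cross product: it is
    bilinear and alternating, [B (x ** y) z = B x (y ** z)], and
    [x ** (x ** y) = (B x y / 2) x - (B x x / 2) y]. Everything about local and
    2-local derivations follows from these laws, from [2 <> 0] and from
    [\dim V = 7].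

    Let [rot a b z = B a z *: b - B b z *: a], the action of [a /\ b] on [V].
    The key identity, [defect_rot], says that the failure of [rot a b] to be a
    derivation depends only on the product [a ** b]. Hence
    [rot a b - rot a' b'] is a derivation as soon as [a ** b = a' ** b'], which
    yields all the derivations that are needed. This is uniform in the
    characteristic, including 3.

    Derivations are skew for [B], hence so are local and 2-local derivations
    ([Der_skew], [TwoLocDer_skew]). Conversely, let [D] be skew and [x != 0].
    Choose [y] with [B x y = 1] and let [w = D x], so that [rot y w] sends [x]
    to [w]. For [c = y ** w] there is an anisotropic vector [a] orthogonal to
    [x], [c] and [c ** x], since a subspace of dimension at least 4 cannot be
    totally isotropic; then [c = a ** b] with [b] also orthogonal to [x], and
    [rot y w - rot a b] is a derivation sending [x] to [D x] ([Der_locally]).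
    When [B] is anisotropic any nonzero vector may serve as [a]; this leaves
    room for five orthogonality constraints, and a skew map agrees with a
    derivation on any two vectors ([Der_locally2]).

    In the split case let [D] be a 2-local derivation. Being skew, [D] is a sum
    of maps [rot a b], so its defect at [x] and [y] is the associator-like
    expression [asc c x y] for a single vector [c] ([skew_defect]). As [D]
    agrees with one derivation at [x] and [y], the defect vanishes whenever
    [x ** y = 0]. There are enough isotropic vectors for this to force [c = 0]
    ([asc_isotropic_eq0]). *)

(** * Nondegenerate symmetric bilinear forms *)

(** A nondegenerate symmetric bilinear form; linearity in the first argument
    follows from symmetry. *)
Record dot_form (F : fieldType) (V : vectType F) (B : V -> V -> F) : Prop :=
  DotForm {
    dotC : forall x y, B x y = B y x;
    dotP : forall (a : F) u v w, B w (a *: u + v) = a * B w u + B w v;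
    dot_nondeg : forall x, (forall y, B x y = 0) -> x = 0 }.

Section DotForm.
Variables (F : fieldType) (V : vectType F) (B : V -> V -> F).
Hypothesis hB : dot_form B.
Implicit Types x y z u v w : V.

Lemma dotDr w u v : B w (u + v) = B w u + B w v.
Proof. by have := dotP hB 1 u v w; rewrite scale1r mul1r. Qed.

Lemma dot0r w : B w 0 = 0.
Proof. by apply: (addrI (B w 0)); rewrite -dotDr !addr0. Qed.

Lemma dotZr a w u : B w (a *: u) = a * B w u.
Proof. by have := dotP hB a u 0 w; rewrite !addr0 dot0r addr0. Qed.

Lemma dotNr w u : B w (- u) = - B w u.
Proof. by rewrite -scaleN1r dotZr mulN1r. Qed.

Lemma dotDl w u v : B (u + v) w = B u w + B v w.
Proof. by rewrite (dotC hB) dotDr !(dotC hB w). Qed.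

Lemma dot0l w : B 0 w = 0.
Proof. by rewrite (dotC hB) dot0r. Qed.

Lemma dotZl a w u : B (a *: u) w = a * B u w.
Proof. by rewrite (dotC hB) dotZr (dotC hB w). Qed.

Lemma dotNl w u : B (- u) w = - B u w.
Proof. by rewrite (dotC hB) dotNr (dotC hB w). Qed.

Definition dotE := (dotDl, dotDr, dotZl, dotZr, dotNl, dotNr, dot0l, dot0r).

Lemma dot_suml I (r : seq I) (P : pred I) (f : I -> V) w :
  B (\sum_(i <- r | P i) f i) w = \sum_(i <- r | P i) B (f i) w.
Proof. by apply: (big_morph (B^~ w)) => [u v|]; rewrite dotE. Qed.

Lemma dot_sumr I (r : seq I) (P : pred I) (f : I -> V) w :
  B w (\sum_(i <- r | P i) f i) = \sum_(i <- r | P i) B w (f i).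
Proof. by apply: (big_morph (B w)) => [u v|]; rewrite dotE. Qed.

Lemma dot_inj u v : (forall z, B u z = B v z) -> u = v.
Proof.
move=> h; apply/eqP; rewrite -subr_eq0; apply/eqP; apply: (dot_nondeg hB) => z.
by rewrite !dotE h subrr.
Qed.

Lemma dot_partner x : x != 0 -> exists y, B x y = 1.
Proof.
move=> x0; have [y Bxy] : exists y, B x y != 0.
  apply: contrapT => h; move/eqP: x0; apply; apply: (dot_nondeg hB) => y.
  by apply: contrapT => /eqP ne; apply: h; exists y.
by exists ((B x y)^-1 *: y); rewrite dotE mulVf.
Qed.

(** The Gram matrix of the form in the coordinates [v2r]. *)
Definition gram : 'M[F]_(dim V) :=
  \matrix_(i, j) B (r2v (delta_mx 0 i)) (r2v (delta_mx 0 j)).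

Lemma v2r_sum u : u = \sum_i v2r u 0 i *: r2v (delta_mx 0 i).
Proof.
rewrite -[LHS]v2rK {1}(row_sum_delta (v2r u)) linear_sum.
by apply: eq_bigr => i _; rewrite linearZ.
Qed.

Lemma dot_gram u v : B u v = (v2r u *m gram *m (v2r v)^T) 0 0.
Proof.
rewrite {1}(v2r_sum u) {1}(v2r_sum v) dot_sumr mxE; apply: eq_bigr => j _.
rewrite dotZr dot_suml mulrC !mxE; congr (_ * _).
by apply: eq_bigr => i _; rewrite dotZl mxE.
Qed.

Lemma gram_unit : gram \in unitmx.
Proof.
rewrite -row_free_unit; apply: inj_row_free => v v0.
apply: (can_inj r2vK); rewrite linear0; apply: (dot_nondeg hB) => y.
by rewrite dot_gram r2vK v0 mul0mx mxE.
Qed.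

(** A matrix whose row space consists of the coordinates of the vectors
    orthogonal to all members of [s]. *)
Lemma orthogonal_mx (s : seq V) : exists A : 'M[F]_(dim V),
  (dim V - size s <= \rank A)%N /\
  forall i v, v \in s -> B v (r2v (row i A)) = 0.
Proof.
pose S : 'M[F]_(size s, dim V) :=
  \matrix_(i < size s) v2r (tnth (in_tuple s) i).
exists (kermx (gram *m S^T)); split.
  by rewrite mxrank_ker leq_sub2l // rank_leq_col.
move=> i v /(tnthP (in_tuple s))[j ->]; rewrite (dotC hB) dot_gram r2vK.
have -> : v2r (tnth (in_tuple s) j) = row j S by rewrite rowK.
rewrite tr_row colE mulmxA -!row_mul -(mulmxA _ gram) mulmx_ker mul0mx row0.
by rewrite mxE.
Qed.

Lemma exists_orthogonal (s : seq V) : (size s < \dim {:V})%N ->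
  exists2 a, a != 0 & forall v, v \in s -> B v a = 0.
Proof.
rewrite dimvf => hs; have [A [rA oA]] := orthogonal_mx s.
have /rowV0Pn[_ /submxP[D ->] nz] : A != 0.
  by rewrite -mxrank_eq0 -lt0n (leq_trans _ rA) // subn_gt0.
exists (r2v (D *m A)) => [|v vs].
  by apply: contra_neq nz => e; rewrite -[LHS]r2vK e linear0.
rewrite mulmx_sum_row linear_sum dot_sumr big1 // => i _.
by rewrite linearZ dotE oA // mulr0.
Qed.

(** A totally isotropic subspace has at most half the dimension of [V], so it
    cannot be the orthogonal of fewer than [\dim V / 2] vectors. *)
Lemma exists_anisotropic_orthogonal (s : seq V) : 2%:R != 0 :> F ->
  (2 * size s < \dim {:V})%N ->
  exists2 a, B a a != 0 & forall v, v \in s -> B v a = 0.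
Proof.
rewrite dimvf => two0 hs; have [A [rA oA]] := orthogonal_mx s.
have iso_rank : A *m gram *m A^T = 0 -> (2 * \rank A <= dim V)%N.
  move=> /mulmx0_rank_max; rewrite mxrank_tr mxrankMfree; last first.
    by rewrite row_free_unit gram_unit.
  by rewrite addnn mul2n.
have [i [j ne]] : exists i j, B (r2v (row i A)) (r2v (row j A)) != 0.
  apply: contrapT => h; suff /iso_rank le : A *m gram *m A^T = 0.
    have : (2 * dim V < dim V + dim V)%N.
      apply: (@leq_ltn_trans (2 * (size s + \rank A))).
        by rewrite leq_mul2l -leq_subLR.
      by rewrite mulnDr -addSn leq_add.
    by rewrite mul2n addnn ltnn.
  apply/matrixP=> i j; rewrite mxE [RHS]mxE.
  have : B (r2v (row i A)) (r2v (row j A)) = 0.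
    by apply: contrapT => /eqP ne; apply: h; exists i, j.
  rewrite dot_gram !r2vK -row_mul !mxE => e; rewrite -[RHS]e.
  by apply: eq_bigr => k _; rewrite !mxE.
set u := r2v (row i A) in ne; set w := r2v (row j A) in ne.
have [u0|] := eqVneq (B u u) 0; last by exists u => // v vs; exact: oA.
have [w0|] := eqVneq (B w w) 0; last by exists w => // v vs; exact: oA.
exists (u + w) => [|v vs]; last by rewrite dotE !oA // addr0.
rewrite !dotE u0 w0 (dotC hB w) add0r addr0 -mulr2n -mulr_natl.
by rewrite mulf_neq0.
Qed.

Lemma dual_basis : exists e f : 'I_(dim V) -> V,
  forall x, x = \sum_i B (f i) x *: e i.
Proof.
pose e i : V := r2v (delta_mx 0 i); exists e.
exists (fun i => r2v (row i (invmx gram))) => x.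
rewrite {1}(v2r_sum x); apply: eq_bigr => i _; congr (_ *: _).
rewrite dot_gram r2vK -row_mul mulVmx ?gram_unit // -row_mul mul1mx !mxE //.
Qed.

End DotForm.

(** * Cross products *)

(** A cross product on a space with a nondegenerate symmetric bilinear form
    [B]: the bracket of the imaginary elements of a composition algebra, with
    [B] the polar form of the norm, so that the norm of [x] is [B x x / 2]. *)
Record cross_product (F : fieldType) (V : vectType F) (B : V -> V -> F)
    (cr : V -> V -> V) : Prop := CrossProduct {
  cross_form : dot_form B;
  crossP : forall (a : F) u v w, cr w (a *: u + v) = a *: cr w u + cr w v;
  crossC : forall x y, cr x y = - cr y x;
  cross_dot : forall x y z, B (cr x y) z = B x (cr y z);
  cross_cross : forall x y,
    cr x (cr x y) = (B x y / 2%:R) *: x - (B x x / 2%:R) *: y }.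

(** The element [a /\ b] of the second exterior power, acting as a
    skew-symmetric endomorphism. *)
Definition rot (F : fieldType) (V : lmodType F) (B : V -> V -> F) (a b : V)
    (z : V) : V := B a z *: b - B b z *: a.

(** The failure of a map [D] to be a derivation of [cr] at [x] and [y]. *)
Definition defect (F : fieldType) (V : lmodType F) (cr : V -> V -> V)
    (D : V -> V) (x y : V) : V := D (cr x y) - cr (D x) y - cr x (D y).

(** The associator of the composition algebra on imaginary elements, up to
    sign. *)
Definition asc (F : fieldType) (V : lmodType F) (B : V -> V -> F)
    (cr : V -> V -> V) (c x y : V) : V :=
  2%:R *: cr c (cr x y) - B c y *: x + B c x *: y.

Section CrossProduct.
Variables (F : fieldType) (V : vectType F) (B : V -> V -> F) (cr : V -> V -> V).
Hypothesis two0 : 2%:R != 0 :> F.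
Hypothesis hX : cross_product B cr.
Implicit Types x y z u v w a b c : V.
Local Notation "x ** y" := (cr x y) (at level 40, left associativity).

Let hB := cross_form hX.
Let bil := dotE hB.

Lemma crossDr w u v : w ** (u + v) = w ** u + w ** v.
Proof. by have := crossP hX 1 u v w; rewrite !scale1r. Qed.

Lemma cross0r w : w ** 0 = 0.
Proof. by apply: (addrI (w ** 0)); rewrite -crossDr !addr0. Qed.

Lemma crossZr k w u : w ** (k *: u) = k *: (w ** u).
Proof. by have := crossP hX k u 0 w; rewrite !addr0 cross0r addr0. Qed.

Lemma crossNr w u : w ** (- u) = - (w ** u).
Proof. by rewrite -scaleN1r crossZr scaleN1r. Qed.

Lemma crossDl w u v : (u + v) ** w = u ** w + v ** w.
Proof. by rewrite (crossC hX) crossDr opprD -!(crossC hX). Qed.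

Lemma cross0l w : 0 ** w = 0.
Proof. by rewrite (crossC hX) cross0r oppr0. Qed.

Lemma crossZl k w u : (k *: u) ** w = k *: (u ** w).
Proof. by rewrite (crossC hX) crossZr -scalerN -(crossC hX). Qed.

Lemma crossNl w u : (- u) ** w = - (u ** w).
Proof. by rewrite (crossC hX) crossNr -(crossC hX). Qed.

Definition crossE :=
  (crossDl, crossDr, crossZl, crossZr, crossNl, crossNr, cross0l, cross0r).

Lemma cross_suml I (r : seq I) (P : pred I) (f : I -> V) w :
  (\sum_(i <- r | P i) f i) ** w = \sum_(i <- r | P i) f i ** w.
Proof. by apply: (big_morph (cr^~ w)) => [u v|]; rewrite crossE. Qed.

Lemma cross_sumr I (r : seq I) (P : pred I) (f : I -> V) w :
  w ** (\sum_(i <- r | P i) f i) = \sum_(i <- r | P i) w ** f i.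
Proof. by apply: (big_morph (cr w)) => [u v|]; rewrite crossE. Qed.

Lemma dot_crossC x y z : B (x ** y) z = - B (y ** x) z.
Proof. by rewrite (crossC hX) bil. Qed.

Lemma dot_cross_rot x y z : B (x ** y) z = B (y ** z) x.
Proof. by rewrite (cross_dot hX) (dotC hB). Qed.

Lemma dot_cross_id x y : B (x ** y) y = 0.
Proof.
have : 2%:R * B (x ** y) y = 0.
  rewrite mulr_natl mulr2n {2}dot_cross_rot (dot_crossC y).
  by rewrite -[B (y ** y) x]dot_cross_rot dot_cross_rot; ring.
by move/eqP; rewrite mulf_eq0 (negPf two0) /= => /eqP.
Qed.

Lemma dot_cross_id2 x y : B (x ** y) x = 0.
Proof. by rewrite dot_crossC dot_cross_id oppr0. Qed.

Lemma dot_cross_cross x y :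
  B (x ** y) (x ** y) = (B x x * B y y - B x y ^+ 2) / 2%:R.
Proof.
rewrite (cross_dot hX) (crossC hX x) crossNr (cross_cross hX) !bil.
by rewrite (dotC hB y x); ring.
Qed.

Lemma cross_cross_lin x y z : x ** (y ** z) + y ** (x ** z) =
  (B x z / 2%:R) *: y + (B y z / 2%:R) *: x - B x y *: z.
Proof.
apply: (dot_inj hB) => w.
have h u : B (u ** (u ** z)) w = B u z / 2%:R * B u w - B u u / 2%:R * B z w.
  by rewrite (cross_cross hX) !bil.
have := h (x + y); rewrite !crossE !bil !h (dotC hB y x) => e.
set s := B (x ** (y ** z)) w in e *; set t := B (y ** (x ** z)) w in e *.
apply/eqP; rewrite -subr_eq0; apply/eqP.
match type of e with ?l = _ => rewrite -[RHS](subrr l) {2}e end.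
by field.
Qed.

(** The imaginary part of the middle Moufang identity
    [(x a) (b x) = x (a b) x]. *)
Lemma cross_moufang x a b z : B ((x ** a) ** (b ** x)) z =
  B x b / 2%:R * B (x ** a) z + B x a / 2%:R * B (b ** x) z
  - B (a ** b) x * B x z + B x x / 2%:R * B (a ** b) z.
Proof.
have swap u v w : u ** (v ** w) = (B u w / 2%:R) *: v + (B v w / 2%:R) *: u
    - B u v *: w - v ** (u ** w).
  by rewrite -cross_cross_lin addrK.
rewrite (cross_dot hX) (crossC hX (b ** x)) (swap z b x) !bil.
rewrite -(cross_dot hX (x ** a) b) (crossC hX (x ** a) b) (swap b x a) !bil.
have -> p : B (x ** p) (z ** x) =
    B x z / 2%:R * B p x - B x x / 2%:R * B p z.
  by rewrite (crossC hX x) bil (cross_dot hX) (crossC hX z) crossNr !bil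
    opprK (cross_cross hX) !bil.
rewrite -!(cross_dot hX) !dot_cross_id2 (dot_crossC b a x) (dot_crossC b a z).
rewrite (dotC hB z x) (dotC hB b x).
rewrite (dot_cross_rot x a b) (dot_crossC b z) (dot_crossC a z).
rewrite (dot_cross_rot z b) (dot_cross_rot z a) (dot_crossC a x).
by field.
Qed.

Lemma cross_moufang_lin x y a b z :
  B ((x ** a) ** (b ** y)) z + B ((y ** a) ** (b ** x)) z =
  (B x b * B (y ** a) z + B y b * B (x ** a) z) / 2%:R
  + (B x a * B (b ** y) z + B y a * B (b ** x) z) / 2%:R
  - B (a ** b) x * B y z - B (a ** b) y * B x z + B x y * B (a ** b) z.
Proof.
have := cross_moufang (x + y) a b z.
rewrite !crossE !bil !cross_moufang (dotC hB y x) => e.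
set s := B ((x ** a) ** (b ** y)) z in e *.
set t := B ((y ** a) ** (b ** x)) z in e *.
apply/eqP; rewrite -subr_eq0; apply/eqP.
match type of e with ?l = _ => rewrite -[RHS](subrr l) {2}e end.
by field.
Qed.

Lemma defect_rot a b x y : defect cr (rot B a b) x y = asc B cr (a ** b) x y.
Proof.
apply: (dot_inj hB) => z; rewrite /defect /rot /asc !crossE !bil.
(* The identity [cross_moufang_lin] exchanges the outer factors of
   [(a ** b) ** (x ** y)] up to sign, modulo simpler terms; three such exchanges
   and anticommutativity lead from the product to its opposite. *)
have -> : 2%:R * B ((a ** b) ** (x ** y)) z =
    B ((a ** b) ** (x ** y)) z + B ((y ** b) ** (x ** a)) z
    + (B ((b ** y) ** (x ** a)) z + B ((a ** y) ** (x ** b)) z)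
    + (B ((x ** y) ** (b ** a)) z + B ((a ** y) ** (b ** x)) z).
  rewrite (crossC hX y b) (crossC hX x b) (crossC hX b a).
  by rewrite (crossC hX (x ** y)) !crossE !bil; ring.
rewrite !cross_moufang_lin -!(cross_dot hX).
have tri u v w : (B (v ** u) w = - B (u ** v) w) * (B (v ** w) u = B (u ** v) w)
    * (B (w ** u) v = B (u ** v) w) * (B (u ** w) v = - B (u ** v) w)
    * (B (w ** v) u = - B (u ** v) w).
  by rewrite -(dot_crossC v u) -!(dot_cross_rot u) -!(dot_cross_rot _ u)
    -!(dot_cross_rot v).
rewrite !(tri a b x) !(tri a b y) !(tri a x y) !(tri b x y).
rewrite (dot_crossC y b z) (dot_crossC y x z) (dot_crossC x a z).
rewrite (dot_crossC x b z) (dot_crossC b a z).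
rewrite ?(dotC hB y a) ?(dotC hB y b) ?(dotC hB y x) ?(dotC hB x a).
rewrite ?(dotC hB x b) ?(dotC hB b a) ?(dotC hB z b).
by field.
Qed.

(** * Derivations and skew-symmetric maps *)

Lemma linear_fun0 (D : V -> V) : linear D -> D 0 = 0.
Proof.
move=> lD; have := lD 1 0 0; rewrite !scale1r addr0 => /eqP.
by rewrite -subr_eq0 opprD addNKr oppr_eq0 => /eqP.
Qed.

Lemma linear_funD (D : V -> V) u v : linear D -> D (u + v) = D u + D v.
Proof. by move=> lD; have := lD 1 u v; rewrite !scale1r. Qed.

Lemma linear_funZ (D : V -> V) k u : linear D -> D (k *: u) = k *: D u.
Proof. by move=> lD; have := lD k u 0; rewrite (linear_fun0 lD) !addr0. Qed.

Lemma linear_fun_sum (D : V -> V) I (r : seq I) (P : pred I) (f : I -> V) :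
  linear D -> D (\sum_(i <- r | P i) f i) = \sum_(i <- r | P i) D (f i).
Proof.
move=> lD; apply: (big_morph D) => [u v|]; first exact: linear_funD.
exact: linear_fun0.
Qed.

(** The orthogonal Lie algebra of [B]; [so q] is [skew (polar q)]. *)
Definition skew (D : V -> V) : Prop := linear D /\ forall v, B v (D v) = 0.

Lemma skewE D u v : skew D -> B (D u) v = - B u (D v).
Proof.
move=> [lD sD]; have := sD (u + v); rewrite linear_funD // !bil !sD.
by rewrite add0r addr0 (dotC hB v) => /eqP; rewrite addrC addr_eq0 => /eqP ->.
Qed.

Lemma rot_linear a b : linear (rot B a b).
Proof. by move=> k u v; apply: (dot_inj hB) => z; rewrite /rot !bil; ring. Qed.

Lemma Der_defect D : linear D ->
  (forall x y, defect cr D x y = 0) -> Der cr D.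
Proof.
move=> lD h; split=> // x y; have /eqP := h x y.
by rewrite /defect -addrA -opprD subr_eq0 => /eqP.
Qed.

Lemma DerD d1 d2 : Der cr d1 -> Der cr d2 -> Der cr (fun z => d1 z + d2 z).
Proof.
move=> [l1 h1] [l2 h2]; split=> [k u v|x y].
  by rewrite l1 l2 scalerDr addrACA.
by rewrite h1 h2 !crossE addrACA.
Qed.

Lemma Der0 : Der cr (fun _ => 0).
Proof.
by split=> [k u v|x y]; rewrite ?scaler0 ?cross0l ?cross0r addr0.
Qed.

Lemma Der_rot_sub a b a' b' : a ** b = a' ** b' ->
  Der cr (fun z => rot B a b z - rot B a' b' z).
Proof.
move=> e; apply: Der_defect => [k u v|x y].
  by rewrite !rot_linear scalerBr opprD addrACA.
have := defect_rot a b x y; rewrite e -defect_rot /defect => /eqP.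
rewrite -subr_eq0 => /eqP h; rewrite -[RHS]h !crossE.
by apply: (dot_inj hB) => z; rewrite !bil; ring.
Qed.

(** Writing [D] as half the sum of the [rot (f i) (D (e i))] over dual bases
    [e] and [f] shows that its defect is governed by a single vector. *)
Lemma skew_defect D : skew D ->
  exists c, forall x y, defect cr D x y = asc B cr c x y.
Proof.
move=> sD; have lD := sD.1; have [e [f ef]] := dual_basis hB.
pose c := 2%:R^-1 *: \sum_i f i ** D (e i); exists c => x y.
have De z : D z = 2%:R^-1 *: \sum_i rot B (f i) (D (e i)) z.
  have -> : \sum_i rot B (f i) (D (e i)) z = 2%:R *: D z; last first.
    by rewrite scalerA mulVf // scale1r.
  apply: (dot_inj hB) => w; rewrite (dot_suml hB) bil.
  under eq_bigr do rewrite /rot !bil.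
  rewrite sumrB.
  have -> : \sum_i B (f i) z * B (D (e i)) w = B (D z) w.
    rewrite {2}(ef z) linear_fun_sum // (dot_suml hB); apply: eq_bigr => i _.
    by rewrite linear_funZ // bil.
  have -> : \sum_i B (D (e i)) z * B (f i) w = - B (D z) w.
    rewrite {2}(ef w) (dot_sumr hB) -sumrN; apply: eq_bigr => i _.
    by rewrite bil (skewE _ _ sD) (dotC hB (D z)) mulNr mulrC.
  by ring.
have ascD u v : asc B cr (u + v) x y = asc B cr u x y + asc B cr v x y.
  by apply: (dot_inj hB) => z; rewrite /asc !crossE !bil; ring.
have ascZ k u : asc B cr (k *: u) x y = k *: asc B cr u x y.
  by apply: (dot_inj hB) => z; rewrite /asc !crossE !bil; ring.
have asc0 : asc B cr 0 x y = 0 by rewrite -[0 in LHS](scale0r 0) ascZ scale0r.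
rewrite /c ascZ (big_morph (fun u => asc B cr u x y) ascD asc0).
rewrite /defect !De !crossE cross_suml cross_sumr -!scalerBr -!sumrB.
by congr (_ *: _); apply: eq_bigr => i _; rewrite -defect_rot.
Qed.

(** Apply [d] to [x ** (x ** a) = - (B x x / 2) a], with [a] anisotropic and
    orthogonal to [x], and pair the result with [a]. *)
Lemma Der_skew d : (2 < \dim {:V})%N -> Der cr d -> skew d.
Proof.
move=> dimV hd; split=> [|x]; first exact: hd.1.
have [a aa /(_ x (mem_head x _)) xa] :=
  exists_anisotropic_orthogonal hB (s := [:: x]) two0 dimV.
have e := cross_cross hX x a; rewrite xa mul0r scale0r sub0r -scaleNr in e.
have := congr1 (B a) (congr1 d e).
rewrite !hd.2 crossDr addrA cross_cross_lin (linear_funZ _ _ hd.1).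
rewrite (cross_cross hX) !bil (dotC hB a x) xa.
rewrite !mulr0 !mul0r !add0r mulNr => /(canRL (addrK _)) /eqP.
by rewrite subrr oppr_eq0 mulf_eq0 (negPf aa) orbF (dotC hB) => /eqP.
Qed.

(** Every [c] factors as [a ** b] with any anisotropic [a] orthogonal to it. *)
Lemma cross_factor a c : B a a != 0 -> B c a = 0 ->
  exists2 b, a ** b = c & forall x, B (c ** x) a = 0 -> B b x = 0.
Proof.
move=> aa ca; exists (- (2%:R / B a a) *: (a ** c)) => [|x cxa].
  rewrite crossZr (cross_cross hX) (dotC hB a c) ca mul0r scale0r sub0r.
  by rewrite scalerN scaleNr opprK scalerA mulrA mulfVK // mulfV // scale1r.
by rewrite bil dot_cross_rot cxa mulr0.
Qed.

(** The map [rot y w] agrees with a derivation on all vectors [x] such that [a]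
    is orthogonal to [x] and to [(y ** w) ** x]: subtract [rot a b], where
    [a ** b = y ** w]. *)
Lemma Der_rot_correction y w a : B a a != 0 -> B (y ** w) a = 0 ->
  exists2 d, Der cr d & forall x, B x a = 0 -> B ((y ** w) ** x) a = 0 ->
    d x = rot B y w x.
Proof.
move=> aa ca; have [b ab bx] := cross_factor aa ca.
exists (fun z => rot B y w z - rot B a b z); first exact: Der_rot_sub.
move=> x xa cxa; rewrite {2}/rot (dotC hB a) xa bx // !scale0r.
by rewrite !subr0.
Qed.

Lemma Der_through x w : (6 < \dim {:V})%N -> x != 0 -> B w x = 0 ->
  exists2 d, Der cr d & d x = w.
Proof.
move=> dimV x0 wx; have [y xy] := dot_partner hB x0.
pose c := y ** w; have [a aa oa] :=
  exists_anisotropic_orthogonal hB (s := [:: c; x; c ** x]) two0 dimV.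
(* Since [B x y = 1] and [B w x = 0], [rot y w] sends [x] to [w]. *)
have [|d dd dE] := @Der_rot_correction y w a aa.
  by apply: oa; rewrite mem_head.
exists d => //; rewrite dE; last 2 first.
- by apply: oa; rewrite !inE eqxx orbT.
- by apply: oa; rewrite !inE eqxx !orbT.
by rewrite /rot (dotC hB y) xy wx scale1r scale0r subr0.
Qed.

Lemma Der_locally D x : (6 < \dim {:V})%N -> skew D ->
  exists2 d, Der cr d & D x = d x.
Proof.
move=> dimV [lD sD]; have [->|x0] := eqVneq x 0.
  by exists (fun _ => 0); [exact: Der0 | exact: linear_fun0].
have [|d dd dx] := @Der_through x (D x) dimV x0; first by rewrite (dotC hB).
by exists d.
Qed.

(** Over an anisotropic form the argument for one vector applies to two: five
    orthogonality constraints leave a nonzero, hence anisotropic, vector. *)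
Lemma Der_locally2 D x y : (6 < \dim {:V})%N ->
  (forall v, B v v = 0 -> v = 0) -> skew D ->
  exists2 d, Der cr d & D x = d x /\ D y = d y.
Proof.
move=> dimV aniso sD; have lD := sD.1.
have [x0|x0] := eqVneq x 0.
  have [d dd dy] := Der_locally y dimV sD; exists d => //.
  by rewrite x0 (linear_fun0 lD) (linear_fun0 dd.1).
have [d1 dd1 dx1] := Der_locally x dimV sD.
have xx : B x x != 0 by apply: contra_neq x0; exact: aniso.
(* After subtracting a derivation that settles [x], it remains to find one that
   kills [x] and sends [y] to [w = D y - d1 y]. The multiple [z] of the
   projection of [y] to the orthogonal of [x] is normalised so that [rot z w]
   does this. *)
pose k := B x y / B x x; pose y' := y - k *: x.
have yE : y = k *: x + y' by rewrite addrC subrK.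
have y'x : B y' x = 0 by rewrite !bil (dotC hB y) /k mulfVK // subrr.
have [y0|y0] := eqVneq y' 0.
  exists d1 => //; split => //; rewrite yE y0 addr0.
  by rewrite (linear_funZ _ _ lD) (linear_funZ _ _ dd1.1) dx1.
have yy : B y' y' != 0 by apply: contra_neq y0; exact: aniso.
pose z := (B y' y')^-1 *: y'.
have zx : B z x = 0 by rewrite bil y'x mulr0.
have zy : B z y = 1.
  rewrite (dotZl hB) yE (dotDr hB y' (k *: x)) (dotZr hB) y'x mulr0 add0r.
  by rewrite mulVf.
have sd1 := Der_skew (ltn_trans (isT : (2 < 6)%N) dimV) dd1.
pose w := D y - d1 y.
have wx : B w x = 0.
  by rewrite /w !bil (skewE _ _ sD) (skewE _ _ sd1) dx1 subrr.
have wy : B w y = 0.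
  by rewrite /w !bil !(dotC hB _ y) sD.2 sd1.2 subrr.
pose c := z ** w; have [a a0 oa] :=
  exists_orthogonal hB (s := [:: c; x; y; c ** x; c ** y]) (ltnW dimV).
have aa : B a a != 0 by apply: contra_neq a0; exact: aniso.
have [|d2 dd2 d2E] := @Der_rot_correction z w a aa.
  by apply: oa; rewrite mem_head.
exists (fun v => d1 v + d2 v); first exact: DerD.
split; rewrite d2E; try by apply: oa; rewrite !inE eqxx ?orbT.
  by rewrite /rot zx wx !scale0r subr0 addr0.
by rewrite /rot zy wy scale0r scale1r subr0 /w addrC subrK.
Qed.

(** A 2-local derivation [D] satisfies [B (D u) v = - B u (D v)], so nondegeneracy
    of [B] makes it linear. *)
Lemma TwoLocDer_skew D : (2 < \dim {:V})%N -> TwoLocDer cr D -> skew D.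
Proof.
move=> dimV tD.
have sD u v : B (D u) v = - B u (D v).
  by have [d /(Der_skew dimV) sd [-> ->]] := tD u v; exact: skewE.
split=> [k u v|v].
  by apply: (dot_inj hB) => z; rewrite sD !bil !sD; ring.
by have [d /(Der_skew dimV) sd [-> _]] := tD v v; exact: sd.2.
Qed.

(** For [x] isotropic and [z] orthogonal to [x], the product of [x] and
    [x ** z] vanishes; testing the vanishing of [asc c] on such pairs makes [c]
    orthogonal to every isotropic vector, and those span the space. *)
Lemma asc_isotropic_eq0 c x0 : (6 < \dim {:V})%N -> x0 != 0 -> B x0 x0 = 0 ->
  (forall x y, x ** y = 0 -> asc B cr c x y = 0) -> c = 0.
Proof.
move=> dimV x0n x0i h.
have iso x : B x x = 0 -> B c x = 0.
  move=> xi; have [->|xn] := eqVneq x 0; first by rewrite bil.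
  apply/eqP; apply/negPn/negP => cx.
  have [y xy] := dot_partner hB xn.
  (* [asc c x (x ** z) = 0] makes [x ** z] a multiple of [x]; orthogonality of
     [z] to [x ** y] makes the factor zero, against [z] being anisotropic. *)
  have [z zz oz] := exists_anisotropic_orthogonal hB
    (s := [:: x; x ** y]) two0 (ltn_trans (isT : (4 < 6)%N) dimV).
  have xz : B x z = 0 by apply: oz; rewrite mem_head.
  have xxz : x ** (x ** z) = 0.
    by rewrite (cross_cross hX) xi xz !mul0r !scale0r subrr.
  have := h _ _ xxz; rewrite /asc xxz crossE scaler0 sub0r addrC => /eqP.
  rewrite subr_eq0 => /eqP e.
  have xzE : x ** z = (B c (x ** z) / B c x) *: x.
    by rewrite mulrC -scalerA -e scalerA mulVf // scale1r.
  have xz0 : x ** z = 0.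
    have := congr1 (B^~ y) xzE.
    rewrite bil xy mulr1 dot_cross_rot dot_cross_rot.
    rewrite dot_crossC (oz (x ** y)) ?oppr0; last by rewrite !inE eqxx orbT.
    by move=> k0; rewrite xzE -k0 scale0r.
  have := cross_cross hX z x; rewrite (crossC hX z x) xz0 oppr0 cross0r.
  rewrite (dotC hB z) xz mul0r scale0r sub0r => /esym/eqP.
  rewrite oppr_eq0 scaler_eq0 (negPf xn) orbF mulf_eq0 (negPf zz).
  by rewrite invr_eq0 (negPf two0).
(* A vector not orthogonal to [x0] is isotropic modulo [x0]. *)
have part v : B v x0 != 0 -> B c v = 0.
  move=> vx; pose u := v - (B v v / 2%:R / B v x0) *: x0.
  have /iso : B u u = 0.
    by rewrite /u !bil (dotC hB x0 v) x0i; field; rewrite vx two0.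
  by rewrite /u !bil (iso x0) // mulr0 subr0.
have [y xy] := dot_partner hB x0n.
have yx : B y x0 != 0 by rewrite (dotC hB) xy oner_neq0.
apply: (dot_nondeg hB) => v; have [vx|] := eqVneq (B v x0) 0; last exact: part.
rewrite -[v](addrK y) (dotDr hB c (v + y)) (dotNr hB) !part ?subrr //.
by rewrite bil vx add0r.
Qed.

Lemma TwoLocDer_isotropic D x0 : (6 < \dim {:V})%N -> x0 != 0 ->
  B x0 x0 = 0 -> TwoLocDer cr D -> Der cr D.
Proof.
move=> dimV x0n x0i tD.
have sD := TwoLocDer_skew (ltn_trans (isT : (2 < 6)%N) dimV) tD.
have [c hc] := skew_defect sD; apply: Der_defect sD.1 _ => x y.
suff c0 : c = 0 by rewrite hc c0 /asc !crossE !bil !scale0r scaler0 subr0 addr0.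
apply: asc_isotropic_eq0 dimV x0n x0i _ => u v uv.
have [d dd [du dv]] := tD u v; rewrite -hc /defect uv (linear_fun0 sD.1) du dv.
by rewrite -addrA -opprD -dd.2 uv (linear_fun0 dd.1) subr0.
Qed.

End CrossProduct.

(** * The imaginary part of a Cayley algebra *)

Section Cayley.
Variables (F : fieldType) (C : cayleyAlgebra F).
Hypothesis two0 : 2%:R != 0 :> F.
Local Notation n := (@cnorm F C).
Local Notation P := (polar (@cnorm F C)).
Local Notation V := (subvs_of (trace0 C)).
Local Notation e1 := (cone C).
Implicit Types (x y z u v w : C) (r s t : V).

Lemma polar_dot_form : dot_form P.
Proof.
split=> [x y|a u v w|x]; first exact: polarC.
- exact: (polarP (cnorm_quadratic C)).
- exact: (@cnorm_nonsingular F C).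
Qed.

Let hP := polar_dot_form.
Let bil := dotE hP.

Lemma polar_diag x : P x x = 2%:R * n x.
Proof.
rewrite /polar -[x + x](scaler_nat 2 x) (cnorm_quadratic C).1.
by ring.
Qed.

Lemma cmulDl u v w : cmul (u + v) w = cmul u w + cmul v w.
Proof.
by have := (cmul_bilinear C).1 w 1 u v => /=; rewrite !scale1r.
Qed.

Lemma cmulDr u v w : cmul w (u + v) = cmul w u + cmul w v.
Proof.
by have := (cmul_bilinear C).2 w 1 u v => /=; rewrite !scale1r.
Qed.

Lemma cmul0r w : cmul w 0 = 0.
Proof. by apply: (addrI (cmul w 0)); rewrite -cmulDr !addr0. Qed.

Lemma cmulZr k u w : cmul w (k *: u) = k *: cmul w u.
Proof.
by have := (cmul_bilinear C).2 w k u 0 => /=; rewrite !addr0 cmul0r addr0.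
Qed.

Lemma cnormD x y : n (x + y) = n x + n y + P x y.
Proof. by rewrite /polar; ring. Qed.

Lemma polar_mull u v w : P (cmul u v) (cmul u w) = n u * P v w.
Proof. by rewrite {1}/polar -cmulDr !cnormM /polar; ring. Qed.

Lemma polar_mulr u v w : P (cmul v u) (cmul w u) = P v w * n u.
Proof. by rewrite {1}/polar -cmulDl !cnormM /polar; ring. Qed.

(** The norm is multiplicative and takes a nonzero value. *)
Lemma cnorm1 : n e1 = 1.
Proof.
have [x nx] : exists x, n x != 0.
  apply: contrapT => h; have n0 x : n x = 0.
    by apply: contrapT => /eqP nx; apply: h; exists x.
  have : \dim {: C} = 0.
    apply/eqP; rewrite dimv_eq0 -subv0; apply/subvP => x _; rewrite memv0.
    apply/eqP; apply: (@cnorm_nonsingular F C) => y.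
    by rewrite /polar !n0 !subr0.
  by rewrite cayley_dim.
by apply: (mulfI nx); rewrite -cnormM cmulx1 mulr1.
Qed.

(** Left and right multiplications by imaginary elements are skew-symmetric. *)
Lemma polar_mul_skewl u v w : ctrace u = 0 ->
  P (cmul u v) w = - P v (cmul u w).
Proof.
move=> tu; have := polar_mull (u + e1) v w.
rewrite !cmulDl !cmul1x !bil !polar_mull cnormD cnorm1.
rewrite -[P u e1]/(ctrace u) tu => e; apply/eqP; rewrite -subr_eq0; apply/eqP.
by match type of e with ?l = _ => rewrite -[RHS](subrr l) {2}e end; ring.
Qed.

Lemma polar_mul_skewr u v w : ctrace u = 0 ->
  P (cmul v u) w = - P v (cmul w u).
Proof.
move=> tu; have := polar_mulr (u + e1) v w.
rewrite !cmulDr !cmulx1 !bil !polar_mulr cnormD cnorm1.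
rewrite -[P u e1]/(ctrace u) tu => e; apply/eqP; rewrite -subr_eq0; apply/eqP.
by match type of e with ?l = _ => rewrite -[RHS](subrr l) {2}e end; ring.
Qed.

Lemma cmul_cmul u w : ctrace u = 0 -> cmul u (cmul u w) = - n u *: w.
Proof.
move=> tu; apply: (dot_inj hP) => z.
by rewrite polar_mul_skewl // polar_mull bil mulNr.
Qed.

(** For imaginary [u] and [v], [u v + v u] is the scalar [- P u v]. *)
Lemma cmul_anti u v : ctrace u = 0 -> ctrace v = 0 ->
  cmul v u = - cmul u v - P u v *: e1.
Proof.
move=> tu tv; have tuv : ctrace (u + v) = 0 by rewrite linearD /= tu tv addr0.
have sq x : ctrace x = 0 -> cmul x x = - n x *: e1.
  by move=> tx; rewrite -(cmul_cmul e1 tx) cmulx1.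
have := sq _ tuv; rewrite !cmulDl !cmulDr cnormD !sq // => e.
apply: (addrI (- n u *: e1 + cmul u v)); apply: (addIr (- n v *: e1)).
rewrite -[LHS]addrA e.
by apply: (dot_inj hP) => z; rewrite !bil; ring.
Qed.

Lemma ctrace_val r : ctrace (vsval r) = 0.
Proof. by have := subvsP r; rewrite memv_ker lfunE => /eqP. Qed.

Lemma dim_trace0 : (6 < \dim (trace0 C))%N.
Proof.
have := limg_ker_dim (linfun (@ctrace F C)) fullv.
rewrite capfv (cayley_dim C : _ = 8%N) -/(trace0 C) => e.
have := dimvS (subvf (limg (linfun (@ctrace F C)))).
rewrite dimvf => le1.
suff: (8 <= \dim (trace0 C) + 1)%N by rewrite addn1.
by rewrite -e leq_add2l.
Qed.

Lemma imaginary_part z :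
  exists k r, z = k *: e1 + vsval r.
Proof.
pose k := ctrace z / 2%:R; have h : z - k *: e1 \in trace0 C.
  rewrite memv_ker lfunE /= /ctrace !bil polar_diag cnorm1 mulr1.
  by rewrite mulfVK // subrr.
by exists k, (Subvs h); rewrite /= addrC subrK.
Qed.

Lemma vsval_malcev r s : vsval (malcev r s) =
  cmul (vsval r) (vsval s) + (P (vsval r) (vsval s) / 2%:R) *: e1.
Proof.
rewrite /= (@cmul_anti (vsval r) (vsval s)) ?ctrace_val //.
by apply: (dot_inj hP) => z; rewrite !bil; field.
Qed.

Lemma polar_norm0 r s : polar (@norm0 F C) r s = P (vsval r) (vsval s).
Proof. by rewrite /polar /norm0 linearD. Qed.

Lemma polar_val1 r : P (vsval r) e1 = 0.
Proof. exact: ctrace_val. Qed.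

Lemma vsvalP a r s : vsval (a *: r + s) = a *: vsval r + vsval s.
Proof. exact: linearP. Qed.

Lemma vsvalN r : vsval (- r) = - vsval r.
Proof. exact: linearN. Qed.

(** The value of the double product comes from the law
    [u (u w) = - n u w]. *)
Lemma malcev_cross_product : cross_product (polar (@norm0 F C)) (@malcev F C).
Proof.
split.
- split=> [r s|a r s t|r h]; first exact: polarC.
    by rewrite !polar_norm0 vsvalP !bil.
  apply: subvs_inj; apply: (@cnorm_nonsingular F C) => z.
  have [k [s ->]] := imaginary_part z.
  by rewrite !bil polar_val1 mulr0 add0r -polar_norm0 h.
- move=> a r s t; apply: subvs_inj; rewrite vsvalP !vsval_malcev vsvalP.
  by rewrite cmulDr cmulZr; apply: (dot_inj hP) => z; rewrite !bil; ring.
- move=> r s; apply: subvs_inj; rewrite vsvalN !vsval_malcev.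
  rewrite (@cmul_anti (vsval r) (vsval s)) ?ctrace_val //.
  by apply: (dot_inj hP) => z; rewrite !bil (polarC _ (vsval s)); field.
- move=> r s t; rewrite !polar_norm0 !vsval_malcev !bil polar_val1.
  rewrite (polarC _ e1) polar_val1 (polar_mul_skewr _ _ (ctrace_val s)).
  rewrite (@cmul_anti (vsval s) (vsval t)) ?ctrace_val // !bil polar_val1.
  by ring.
- move=> r s; apply: subvs_inj.
  rewrite -scaleNr vsvalP vsval_malcev.
  have -> : vsval (- (polar (@norm0 F C) r r / 2%:R) *: s) =
      - (P (vsval r) (vsval r) / 2%:R) *: vsval s.
    by rewrite -polar_norm0; exact: linearZ.
  have -> : P (vsval r) (vsval (malcev r s)) = 0.
    rewrite vsval_malcev !bil polar_val1 mulr0 addr0.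
    by have := polar_mull (vsval r) e1 (vsval s);
      rewrite cmulx1 => ->; rewrite (polarC _ e1) polar_val1 mulr0.
  rewrite vsval_malcev cmulDr cmulZr cmulx1 cmul_cmul ?ctrace_val //.
  rewrite polar_norm0 polar_diag.
  by apply: (dot_inj hP) => z; rewrite !bil; field.
Qed.

Lemma dim_imaginary : (6 < \dim {: V})%N.
Proof. by rewrite dimvf; exact: dim_trace0. Qed.

(** If [z = k + r] is isotropic with [k != 0], and [s] is anisotropic and
    orthogonal to [r], then [k s + [r, s]] and [- k s + [r, s]] are isotropic, and they are
    not both zero. *)
Lemma isotropic_imaginary : split_cayley C ->
  exists2 r : V, r != 0 & polar (@norm0 F C) r r = 0.
Proof.
pose B := polar (@norm0 F C).
have hX : cross_product B (@malcev F C) := malcev_cross_product.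
have hB : dot_form B := cross_form hX.
move=> [z [z0 nz]]; have [k [r zE]] := imaginary_part z.
have rr : B r r = - 2%:R * k ^+ 2.
  have : 2%:R * n z = 2%:R * k ^+ 2 + B r r.
    rewrite -polar_diag zE !bil polar_val1 (polarC _ e1) polar_val1 polar_diag.
    by rewrite cnorm1 /B polar_norm0; ring.
  by rewrite nz mulr0 => /esym/eqP; rewrite addrC addr_eq0 mulNr => /eqP.
have [k0|k0] := eqVneq k 0.
  exists r; last by rewrite -/(B r r) rr k0 expr0n mulr0.
  by apply: contra_neq z0 => r0; rewrite zE k0 r0 scale0r add0r linear0.
have [s ss /(_ r (mem_head r _)) rs] := exists_anisotropic_orthogonal hB
  (s := [:: r]) two0 (ltn_trans (isT : (2 < 6)%N) dim_imaginary).
have iso e : e ^+ 2 = k ^+ 2 ->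
    B (e *: s + malcev r s) (e *: s + malcev r s) = 0.
  move=> ek; rewrite !(dotE hB) (dot_cross_cross hX) (dotC hB s).
  rewrite (dot_cross_id two0 hX) rs -/(B r r) rr.
  have -> : k ^+ 2 = e ^+ 2 by [].
  by field.
have [u0|] := eqVneq (k *: s + malcev r s) 0; last first.
  by exists (k *: s + malcev r s) => //; exact: iso.
exists (- k *: s + malcev r s); last by apply: iso; rewrite sqrrN.
apply: contra_neq ss => v0.
have : (2%:R * k) *: s = 0.
  rewrite -(subrr 0) -{1}u0 -v0; apply: (dot_inj hB) => t.
  by rewrite !(dotE hB); ring.
move/eqP; rewrite scaler_eq0 mulf_eq0 (negPf two0) (negPf k0) => /eqP ->.
by rewrite (dotE hB).
Qed.

Lemma anisotropic_imaginary : division_cayley C ->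
  forall r : V, polar (@norm0 F C) r r = 0 -> r = 0.
Proof.
move=> div r rr; apply: contrapT => /eqP r0; apply: div.
exists (vsval r); split.
  by apply: contra_neq r0 => e; apply: subvs_inj; rewrite e linear0.
move/eqP: rr; rewrite polar_norm0 polar_diag mulf_eq0 (negPf two0).
by move=> /eqP.
Qed.

Lemma norm0_quadratic : quadratic_form (@norm0 F C).
Proof.
have hB := cross_form malcev_cross_product.
split=> [a r|].
  by rewrite -(cnorm_quadratic C).1; congr cnorm; exact: linearZ.
split=> r a s t /=; first by rewrite !(dotE hB).
by rewrite !(dotE hB).
Qed.

End Cayley.

Lemma lie_isomorphic_refl (F : fieldType) (V : lmodType F) (L : set (V -> V)) :
  bracket_closed L -> lie_isomorphic L L.
Proof.
move=> cL; split=> //; exists id; split=> //; split=> // f Lf; by exists f.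
Qed.

Theorem theorem5p1 (F : fieldType) (C : cayleyAlgebra F)
    (char_neq2 : 2%N \notin [pchar F]) :
  LocDer (@malcev F C) = so (@norm0 F C)
  /\ (split_cayley C ->
      forall D : subvs_of (trace0 C) -> subvs_of (trace0 C),
        TwoLocDer (@malcev F C) D -> Der (@malcev F C) D)
  /\ (division_cayley C ->
      lie_isomorphic (TwoLocDer (@malcev F C)) (LocDer (@malcev F C))
      /\ lie_isomorphic (LocDer (@malcev F C)) (so (@norm0 F C))).
Proof.
have two0 : 2%:R != 0 :> F by move: char_neq2; rewrite inE /=.
have hX := malcev_cross_product C two0.
have dimV := dim_imaginary C.
have dim2 := ltn_trans (isT : (2 < 6)%N) dimV.
have LocE : LocDer (@malcev F C) = so (@norm0 F C).
  apply/seteqP; split=> D [lD hD]; split=> // v.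
    by have [d /(Der_skew two0 hX dim2)[_ sd] ->] := hD v; exact: sd.
  exact: (Der_locally two0 hX v dimV (conj lD hD)).
split=> //; split=> [/(isotropic_imaginary two0)[r r0 rr] D | div].
  exact: (TwoLocDer_isotropic two0 hX dimV r0 rr).
have TwoE : TwoLocDer (@malcev F C) = so (@norm0 F C).
  apply/seteqP; split=> D hD; first exact: (TwoLocDer_skew two0 hX dim2 hD).
  move=> x y.
  exact: (Der_locally2 two0 hX x y dimV (anisotropic_imaginary two0 div) hD).
rewrite TwoE LocE; split; apply: lie_isomorphic_refl; apply: so_bracket_closed.
  exact: norm0_quadratic.
exact: norm0_quadratic.
Qed.
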